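(* Let $(X,\mathcal{A})$ be a measurable space and let $\mu\colon\mathcal{A}\to[0,\infty]$ be a nonadditive measure. Assume that $\mu$ is weakly null-additive and null-continuous. Then $\mathcal{L}^\infty(\mu)$ is complete with respect to the seminorm $\|\cdot\|_\infty$ and $L^\infty(\mu)$ is complete with respect to the norm $\|\cdot\|_\infty$.
   Context: $X$ is a nonempty set and $\mathcal{A}$ is a $\sigma$-field of subsets of $X$. A nonadditive measure is a set function $\mu\colon\mathcal{A}\to[0,\infty]$ with $\mu(\emptyset)=0$ and $\mu(A)\le\mu(B)$ whenever $A,B\in\mathcal{A}$, $A\subset B$. $\mathcal{F}_0(X)$ is the real linear space of all $\mathcal{A}$-measurable functions $X\to\mathbb{R}$. Weakly null-additive: $\mu(A\cup B)=0$ whenever $A,B\in\mathcal{A}$ and $\mu(A)=\mu(B)=0$. Null-continuous: $\mu(\bigcup_{n=1}^\infty N_n)=0$ whenever $\{N_n\}_{n\in\mathbb{N}}\subset\mathcal{A}$ is nondecreasing and $\mu(N_n)=0$ for every $n$. For $f\in\mathcal{F}_0(X)$ let $\|f\|_\infty:=\inf\{c>0:\mu(\{|f|>c\})=0\}\in[0,\infty]$ (with $\inf\emptyset=\infty$) and $\mathcal{L}^\infty(\mu):=\{f\in\mathcal{F}_0(X):\|f\|_\infty<\infty\}$. For $\mu$ weakly null-additive, $f\sim g$ iff $\mu(\{|f-g|>c\})=0$ for every $c>0$ is an equivalence relation on $\mathcal{F}_0(X)$; $[f]$ is the class of $f$, with $[f]+[g]:=[f+g]$, $c[f]:=[cf]$;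 $L^\infty(\mu):=\{[f]:f\in\mathcal{L}^\infty(\mu)\}$ and $\|[f]\|_\infty:=\|f\|_\infty$ (well-defined when $\mu$ is weakly null-additive). Complete means that every Cauchy sequence in the space (for any $\varepsilon>0$ there is $n_0$ with $\|x_m-x_n\|_\infty<\varepsilon$ for $m,n\ge n_0$) converges to an element $x$ of the space ($\|x_n-x\|_\infty\to0$). *)

(* Defs.v *)
From HB Require Import structures.
From mathcomp Require Import all_boot all_order all_algebra.
From mathcomp Require Import generic_quotient.
From mathcomp Require Import all_classical all_reals all_analysis measurable_realfun.

Set Implicit Arguments.
Unset Strict Implicit.
Unset Printing Implicit Defensive.

Import Order.TTheory GRing.Theory Num.Theory.
Import numFieldNormedType.Exports.

Local Open Scope classical_set_scope.
Local Open Scope ring_scope.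

(* A set function on the sigma-field is represented by a total function on
   [set T] that is only constrained on measurable sets. *)
Record nonadditive_measure d (T : measurableType d) (R : realType) :=
  NonadditiveMeasure {
    nam_fun :> set T -> \bar R ;
    nam_ge0 : forall A, measurable A -> (0 <= nam_fun A)%E ;
    nam_set0 : nam_fun set0 = 0%E ;
    nam_le : forall A B, measurable A -> measurable B ->
      A `<=` B -> (nam_fun A <= nam_fun B)%E
  }.

Section nonadditive.
Context d (T : measurableType d) (R : realType).
Variable mu : nonadditive_measure T R.
Implicit Types f g h : {mfun T >-> R}.

Definition weakly_null_additive := forall A B : set T,
  measurable A -> measurable B -> mu A = 0%E -> mu B = 0%E ->
  mu (A `|` B) = 0%E.

Definition null_continuous := forall N : (set T)^nat,
  (forall n, measurable (N n)) -> (forall n, N n `<=` N n.+1) ->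
  (forall n, mu (N n) = 0%E) -> mu (\bigcup_n N n) = 0%E.

Definition essnorm (f : {mfun T >-> R}) : \bar R :=
  ereal_inf [set c%:E | c in [set c : R | 0 < c /\
                                mu [set t | c < `|f t|] = 0%E]].

Definition calLinfty : set {mfun T >-> R} := [set f | (essnorm f < +oo)%E].

Definition musim (f g : {mfun T >-> R}) : Prop :=
  forall c : R, 0 < c -> mu [set t | c < `|f t - g t|] = 0%E.

Definition musimb (f g : {mfun T >-> R}) : bool := `[< musim f g >].

Lemma measurable_abs_gt (f : {mfun T >-> R}) (c : R) :
  measurable [set t | c < `|f t|].
Proof.
have mf : measurable_fun setT (fun t => `|f t|).
  by apply: measurableT_comp.
have := mf measurableT _ (measurable_itv `]c, +oo[).
by rewrite setTI; congr measurable; apply/seteqP; split => t /=;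
  rewrite in_itv/= andbT.
Qed.

Lemma null_le (A B : set T) : measurable A -> measurable B ->
  A `<=` B -> mu B = 0%E -> mu A = 0%E.
Proof.
move=> mA mB AB B0; apply/eqP; rewrite eq_le nam_ge0// andbT -B0.
exact: nam_le.
Qed.

Lemma essnorm_ge0 f : (0 <= essnorm f)%E.
Proof.
by apply: le_ereal_inf_tmp => _ /= [c [c0 _] <-]; rewrite lee_fin ltW.
Qed.

Lemma essnorm_lt f (a : R) : 0 < a -> (essnorm f < a%:E)%E ->
  mu [set t | a < `|f t|] = 0%E.
Proof.
move=> a0 /ereal_inf_lt[_ [c [c0 fc] <-]]; rewrite lte_fin => ca.
apply: null_le fc; [exact: measurable_abs_gt..|].
by move=> t /=; exact: lt_trans.
Qed.

Lemma essnorm_le f (a : R) : 0 < a -> mu [set t | a < `|f t|] = 0%E ->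
  (essnorm f <= a%:E)%E.
Proof. by move=> a0 fa; apply: ereal_inf_lbound; exists a. Qed.

Lemma essnorm0P f : essnorm f = 0%E <->
  forall c : R, 0 < c -> mu [set t | c < `|f t|] = 0%E.
Proof.
split=> [f0 c c0|f0]; first by apply: essnorm_lt => //; rewrite f0 lte_fin.
apply/eqP; rewrite eq_le essnorm_ge0 andbT.
apply/lee_addgt0Pr => e e0; rewrite add0e; exact: essnorm_le (f0 _ e0).
Qed.

Lemma musimE f g : musim f g <-> essnorm (f - g) = 0%E.
Proof. exact: iff_sym (essnorm0P (f - g)). Qed.

Hypothesis hw : weakly_null_additive.

Lemma essnormD f g : (essnorm (f + g)%R <= essnorm f + essnorm g)%E.
Proof.
have [->|fy] := eqVneq (essnorm f) +oo%E.
  by rewrite addye ?leey// gt_eqF// (lt_le_trans _ (essnorm_ge0 g))// ltNy0.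
have [->|gy] := eqVneq (essnorm g) +oo%E.
  by rewrite addey ?leey// gt_eqF// (lt_le_trans _ (essnorm_ge0 f))// ltNy0.
have ffin : essnorm f \is a fin_num by rewrite ge0_fin_numE ?essnorm_ge0// ltey.
have gfin : essnorm g \is a fin_num by rewrite ge0_fin_numE ?essnorm_ge0// ltey.
rewrite -(fineK ffin) -(fineK gfin) -EFinD.
apply/lee_addgt0Pr => e e0.
set a := fine (essnorm f) + e / 2; set b := fine (essnorm g) + e / 2.
have e20 : 0 < e / 2 by rewrite divr_gt0.
have a0 : 0 < a by rewrite ltr_wpDl// fine_ge0// essnorm_ge0.
have b0 : 0 < b by rewrite ltr_wpDl// fine_ge0// essnorm_ge0.
have -> : ((fine (essnorm f) + fine (essnorm g))%:E + e%:E)%E = (a + b)%:E.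
  by rewrite -EFinD /a /b addrACA -splitr.
apply: essnorm_le; first by rewrite addr_gt0.
have fa : mu [set t | a < `|f t|] = 0%E.
  by apply: essnorm_lt => //; rewrite -(fineK ffin) lte_fin ltrDl.
have gb : mu [set t | b < `|g t|] = 0%E.
  by apply: essnorm_lt => //; rewrite -(fineK gfin) lte_fin ltrDl.
apply: null_le (hw _ _ fa gb); try exact: measurable_abs_gt.
  by apply: measurableU; exact: measurable_abs_gt.
move=> t /= abt; have [fat|] := ltP a `|f t|; [by left|move=> fat; right].
rewrite ltNge; apply: contraTN abt => gbt; rewrite -leNgt.
exact: le_trans (ler_normD _ _) (lerD _ _).
Qed.

Lemma essnormZ (a : R) f : (essnorm (a *: f)%R = `|a|%:E * essnorm f)%E.
Proof.
have leZ (b : R) g : b != 0 -> (essnorm (b *: g)%R <= `|b|%:E * essnorm g)%E.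
  move=> b0; have b0' : 0 < `|b| by rewrite normr_gt0.
  rewrite -lee_pdivrMl//; apply: le_ereal_inf_tmp => _ [c [c0 gc] <-].
  rewrite lee_pdivrMl// -EFinM; apply: essnorm_le; first by rewrite mulr_gt0.
  rewrite -gc; congr (mu _); apply/seteqP; split => t /=;
    by rewrite /GRing.scale/= normrM ltr_pM2l.
have [->|a0] := eqVneq a 0.
  rewrite normr0 mul0e scale0r; apply/essnorm0P => c c0.
  rewrite -(nam_set0 mu); congr (mu _); apply/seteqP; split => t //=.
  by rewrite normr0 ltNge ltW.
apply/eqP; rewrite eq_le leZ//=.
have a0' : 0 < `|a| by rewrite normr_gt0.
rewrite -lee_pdivlMl//.
have := leZ a^-1 (a *: f); rewrite invr_eq0 scalerA mulVf// scale1r normfV.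
exact.
Qed.

Lemma essnormN f : essnorm (- f) = essnorm f.
Proof. by rewrite -scaleN1r essnormZ normrN1 mul1e. Qed.

Lemma musimbE f g : musimb f g = (essnorm (f - g) == 0%E).
Proof. by apply/asboolP/eqP => /musimE. Qed.

Lemma musimb_refl : reflexive musimb.
Proof.
by move=> f; rewrite musimbE subrr -(scale0r 0) essnormZ normr0 mul0e.
Qed.

Lemma musimb_sym : symmetric musimb.
Proof. by move=> f g; rewrite !musimbE -(essnormN (f - g)) opprB. Qed.

Lemma musimb_trans : transitive musimb.
Proof.
move=> g f h; rewrite !musimbE => /eqP fg /eqP gh.
rewrite eq_le essnorm_ge0 andbT -[f](subrK g) -addrA.
by apply: (le_trans (essnormD _ _)); rewrite fg gh adde0.
Qed.

Definition musim_equiv : equiv_rel {mfun T >-> R} :=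
  EquivRel musimb musimb_refl musimb_sym musimb_trans.

Local Open Scope quotient_scope.

Definition L0 : Type := {eq_quot musim_equiv}.
HB.instance Definition _ := Choice.on L0.
HB.instance Definition _ := EqQuotient.on L0.

Definition class_of (f : {mfun T >-> R}) : L0 := \pi_L0 f.

Lemma class_of_eq f g : class_of f = class_of g <-> musim f g.
Proof.
split=> [/eqP|fg]; first by rewrite /class_of eqmodE => /asboolP.
by apply/eqP; rewrite /class_of eqmodE; exact/asboolP.
Qed.

Definition L0_zero : L0 := class_of 0.
Definition L0_opp (x : L0) : L0 := class_of (- repr x).
Definition L0_add (x y : L0) : L0 := class_of (repr x + repr y).
Definition L0_scale (a : R) (x : L0) : L0 := class_of (a *: repr x).

Lemma repr_class_of f : essnorm (repr (class_of f) - f) = 0%E.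
Proof. by apply/musimE/class_of_eq; rewrite /class_of reprK. Qed.

Lemma class_of_repr (x : L0) : class_of (repr x) = x.
Proof. by rewrite /class_of reprK. Qed.

Lemma L0_addE f g : L0_add (class_of f) (class_of g) = class_of (f + g).
Proof.
apply/class_of_eq/musimE/eqP; rewrite eq_le essnorm_ge0 andbT opprD addrACA.
by apply: (le_trans (essnormD _ _)); rewrite !repr_class_of adde0.
Qed.

Lemma L0_scaleE a f : L0_scale a (class_of f) = class_of (a *: f).
Proof.
by apply/class_of_eq/musimE; rewrite -scalerBr essnormZ repr_class_of mule0.
Qed.

Lemma L0_oppE f : L0_opp (class_of f) = class_of (- f).
Proof.
by apply/class_of_eq/musimE; rewrite -opprD essnormN repr_class_of.
Qed.

Lemma L0_addA : associative L0_add.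
Proof.
move=> x y z; rewrite -(class_of_repr x) -(class_of_repr y) -(class_of_repr z).
by rewrite !L0_addE addrA.
Qed.

Lemma L0_addC : commutative L0_add.
Proof. by move=> x y; rewrite /L0_add addrC. Qed.

Lemma L0_add0 : left_id L0_zero L0_add.
Proof. by move=> x; rewrite -(class_of_repr x) L0_addE add0r. Qed.

Lemma L0_addN : left_inverse L0_zero L0_opp L0_add.
Proof. by move=> x; rewrite -(class_of_repr x) L0_oppE L0_addE addNr. Qed.

HB.instance Definition _ :=
  GRing.isZmodule.Build L0 L0_addA L0_addC L0_add0 L0_addN.

Lemma L0_scaleA a b (x : L0) :
  L0_scale a (L0_scale b x) = L0_scale (a * b) x.
Proof. by rewrite -(class_of_repr x) !L0_scaleE scalerA. Qed.

Lemma L0_scale1 : left_id 1 L0_scale.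
Proof. by move=> x; rewrite /L0_scale scale1r class_of_repr. Qed.

Lemma L0_scaleDr : right_distributive L0_scale +%R.
Proof.
move=> a x y; rewrite -(class_of_repr x) -(class_of_repr y) /GRing.add/=.
by rewrite L0_addE !L0_scaleE L0_addE scalerDr.
Qed.

Lemma L0_scaleDl (x : L0) : {morph L0_scale^~ x : a b / a + b}.
Proof.
move=> a b; rewrite -(class_of_repr x) [in RHS]/GRing.add/=.
by rewrite !L0_scaleE L0_addE scalerDl.
Qed.

HB.instance Definition _ := GRing.Zmodule_isLmodule.Build R L0
  L0_scaleA L0_scale1 L0_scaleDr L0_scaleDl.

Lemma class_ofD f g : class_of (f + g) = class_of f + class_of g.
Proof. exact/esym/L0_addE. Qed.

Lemma class_ofZ a f : class_of (a *: f) = a *: class_of f.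
Proof. exact/esym/L0_scaleE. Qed.

Definition Linfty : set L0 := class_of @` calLinfty.

Definition Lnorm_infty (x : L0) : \bar R := essnorm (repr x).

(* The norm of a class does not depend on the representative. *)
Lemma Lnorm_inftyE f : Lnorm_infty (class_of f) = essnorm f.
Proof.
rewrite /Lnorm_infty; set g := repr _.
have gf : essnorm (g - f) = 0%E := repr_class_of f.
apply/eqP; rewrite eq_le; apply/andP; split.
- rewrite -{1}[g](subrK f); apply: (le_trans (essnormD _ _)).
  by rewrite gf add0e.
- rewrite -{1}[f](subrK g); apply: (le_trans (essnormD _ _)).
  by rewrite -opprB essnormN gf add0e.
Qed.

Lemma Lnorm_inftyD x y :
  (Lnorm_infty (x + y)%R <= Lnorm_infty x + Lnorm_infty y)%E.
Proof.
rewrite -(class_of_repr x) -(class_of_repr y) -class_ofD !Lnorm_inftyE.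
exact: essnormD.
Qed.

Lemma Lnorm_inftyZ a x : (Lnorm_infty (a *: x)%R = `|a|%:E * Lnorm_infty x)%E.
Proof.
by rewrite -(class_of_repr x) -class_ofZ !Lnorm_inftyE essnormZ.
Qed.

Lemma Lnorm_infty_eq0 x : Lnorm_infty x = 0%E <-> x = 0.
Proof.
rewrite -(class_of_repr x) Lnorm_inftyE; split=> [x0|].
  by apply/class_of_eq/musimE; rewrite subr0.
by move/class_of_eq/musimE; rewrite subr0.
Qed.

End nonadditive.

Arguments Linfty {d T R mu} hw _.
Arguments Lnorm_infty {d T R mu} hw x.

Section completeness.
Context (R : realType) (V : zmodType).

Definition seminorm_cauchy (N : V -> \bar R) (u : V^nat) :=
  forall e : R, 0 < e -> exists n0 : nat, forall m n : nat,
    (n0 <= m)%N -> (n0 <= n)%N -> (N (u m - u n)%R < e%:E)%E.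

Definition seminorm_complete (A : set V) (N : V -> \bar R) :=
  forall u : V^nat, (forall n, A (u n)) -> seminorm_cauchy N u ->
  exists2 x, A x & N (u n - x) @[n --> \oo] --> 0%E.

End completeness.

(* Main.v *)
(* A countable union of null sets is null: weak null-additivity handles finite
   unions and null-continuity the increasing limit. Hence, for a Cauchy sequence
   [u] with modulus [N], the set [E] where |u m - u n| > 1/(k+1) for some k and
   some m, n >= N k is null. Outside [E] the sequence is uniformly Cauchy, and
   its pointwise limit there, extended by 0 on [E], is the limit of [u]. *)
From HB Require Import structures.
Require Import Defs.
From mathcomp Require Import all_boot all_order all_algebra.
From mathcomp Require Import all_classical all_reals all_analysis measurable_realfun.

Set Implicit Arguments.
Unset Strict Implicit.
Unset Printing Implicit Defensive.

Import Order.TTheory GRing.Theory Num.Theory.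
Import numFieldNormedType.Exports.

Local Open Scope classical_set_scope.
Local Open Scope ring_scope.

(** Countable choice over the tolerances 1/(k+1): with real tolerances replaced by naturals, only
    countably many exceptional sets have to be united. *)
Lemma cauchy_modulus (R : realType) (V : zmodType) (N : V -> \bar R)
    (u : V^nat) : seminorm_cauchy N u ->
  exists p : nat -> nat, forall k m n, (p k <= m)%N -> (p k <= n)%N ->
    (N (u m - u n)%R < (k.+1%:R^-1)%:E)%E.
Proof.
move=> cu.
have ck k : exists n0, forall m n, (n0 <= m)%N -> (n0 <= n)%N ->
    (N (u m - u n)%R < (k.+1%:R^-1)%:E)%E by apply: cu; rewrite invr_gt0.
by have [p Hp] := choice ck; exists p.
Qed.

Lemma inv_natS_lt (R : realType) (e : R) :
  0 < e -> exists k : nat, k.+1%:R^-1 < e.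
Proof. by move=> /ltr_add_invr[k]; rewrite add0r; exists k. Qed.

Section uniform_modulus.
Variables (R : realType) (v : R^nat) (p : nat -> nat).
Hypothesis vp : forall k m n, (p k <= m)%N -> (p k <= n)%N ->
  `|v m - v n| <= k.+1%:R^-1.

Lemma modulus_cvgn : cvgn v.
Proof.
apply/cauchy_cvgP/cauchy_exP => e /inv_natS_lt[k ke].
exists (v (p k)); exists (p k) => // n /= pn.
by rewrite /ball/= (le_lt_trans _ ke)// vp.
Qed.

(** Let m tend to infinity in [vp]. The rate is unchanged, so one modulus valid at all points gives
    uniform convergence. *)
Lemma modulus_limn k n : (p k <= n)%N -> `|v n - limn v| <= k.+1%:R^-1.
Proof.
move=> pn.
have cv : `|v n - v m| @[m --> \oo] --> `|v n - limn v|.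
  by apply: cvg_norm; apply: cvgB; [exact: cvg_cst|exact: modulus_cvgn].
rewrite -(cvg_lim _ cv)//; apply: limr_le; first exact: cvgP cv.
by exists (p k) => // m /= pm; exact: vp.
Qed.

End uniform_modulus.

Section completeness.
Context d (T : measurableType d) (R : realType).
Variable mu : nonadditive_measure T R.
Hypotheses (hw : weakly_null_additive mu) (hc : null_continuous mu).

Lemma null_bigsetU (F : (set T)^nat) n :
  (forall i, measurable (F i)) -> (forall i, mu (F i) = 0%E) ->
  mu (\big[setU/set0]_(i < n) F i) = 0%E.
Proof.
move=> mF F0; elim: n => [|n IH]; first by rewrite big_ord0 nam_set0.
rewrite big_ord_recr/=; apply: hw => //.
exact: bigsetU_measurable.
Qed.

Lemma null_bigcup (D : set nat) (F : (set T)^nat) :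
  (forall i, D i -> measurable (F i)) -> (forall i, D i -> mu (F i) = 0%E) ->
  mu (\bigcup_(i in D) F i) = 0%E.
Proof.
(* Indices outside [D] contribute [set0], which is null, so the union may run over all naturals. *)
move=> mF F0; rewrite bigcup_mkcond.
set G := fun i => _.
have mG i : measurable (G i) by rewrite /G; case: ifPn => // /set_mem/mF.
have G0 i : mu (G i) = 0%E.
  by rewrite /G; case: ifPn => [/set_mem/F0//|_]; rewrite nam_set0.
rewrite -bigcup_bigsetU_bigcup; apply: hc => n.
- by apply: bigsetU_measurable => i _; exact: mG.
- by rewrite [X in _ `<=` X]big_ord_recr/=; exact: subsetUl.
- exact: null_bigsetU mG G0.
Qed.

Lemma cauchy_uniform_off_null (u : {mfun T >-> R}^nat) (p : nat -> nat) :
  (forall k m n, (p k <= m)%N -> (p k <= n)%N ->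
    (essnorm mu (u m - u n)%R < (k.+1%:R^-1)%:E)%E) ->
  exists E, [/\ measurable E, mu E = 0%E & forall t, ~ E t ->
    forall k m n, (p k <= m)%N -> (p k <= n)%N ->
      `|u m t - u n t| <= k.+1%:R^-1].
Proof.
move=> up.
pose A k m n := [set t | k.+1%:R^-1 < `|(u m - u n) t|].
have mA k m n : measurable (A k m n) by exact: measurable_abs_gt.
exists (\bigcup_k \bigcup_(m in [set m | (p k <= m)%N])
  \bigcup_(n in [set n | (p k <= n)%N]) A k m n); split.
- by do 3![apply: bigcup_measurable => ? ?].
- apply: null_bigcup => k _.
    by do 2![apply: bigcup_measurable => ? ?].
  apply: null_bigcup => m pm; first by apply: bigcup_measurable => ? ?.
  (* The strict bound in [up] matters: it yields an admissible c below 1/(k+1), so the level set at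
     1/(k+1) lies in a null one. *)
  apply: null_bigcup => // n pn; apply: essnorm_lt; first by rewrite invr_gt0.
  exact: up.
- move=> t Et k m n pm pn; rewrite leNgt; apply/negP => tA; apply: Et.
  by exists k => //; exists m => //; exists n.
Qed.

Lemma cauchy_limit (u : {mfun T >-> R}^nat) (p : nat -> nat) :
  (forall k m n, (p k <= m)%N -> (p k <= n)%N ->
    (essnorm mu (u m - u n)%R < (k.+1%:R^-1)%:E)%E) ->
  exists f : {mfun T >-> R}, forall k n, (p k <= n)%N ->
    (essnorm mu (u n - f)%R <= (k.+1%:R^-1)%:E)%E.
Proof.
move=> /cauchy_uniform_off_null[E [mE E0 uE]].
(* Every [g n] vanishes on [E], so the modulus [p] holds at all points and the limit exists
   everywhere, hence is measurable. *)
pose g n (t : T) : R := u n t * \1_(~` E) t.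
have gE t k m n : (p k <= m)%N -> (p k <= n)%N ->
    `|g m t - g n t| <= k.+1%:R^-1.
  move=> pm pn; rewrite /g -mulrBl indicE.
  have [/set_mem tE|_] := boolP (t \in ~` E); first by rewrite mulr1 uE.
  by rewrite mulr0 normr0 invr_ge0.
have mf : measurable_fun setT (fun t => limn (g ^~ t)).
  apply: (@measurable_fun_cvg _ _ _ _ g) => [n|t _].
    by apply: measurable_funM => //; apply: measurable_indic; exact: measurableC.
  exact: modulus_cvgn (gE t).
pose f : {mfun T >-> R} := HB.pack (fun t => limn (g ^~ t))
  (@isMeasurableFun.Build _ _ _ _ (fun t => limn (g ^~ t)) mf).
exists f => k n pn; apply: essnorm_le; first by rewrite invr_gt0.
(* The exceptional set lies inside [E]: off [E], [g n] equals [u n] and [modulus_limn] bounds the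
   distance to the limit. *)
apply: null_le E0 => //; first exact: measurable_abs_gt.
move=> t /= ft; apply: contrapT => tE; move: ft; apply/negP; rewrite -leNgt.
have := modulus_limn (gE t) pn.
by rewrite {1}/g indicE mem_set// mulr1.
Qed.

Lemma calLinfty_complete : seminorm_complete (calLinfty mu) (essnorm mu).
Proof.
move=> u uL /cauchy_modulus[p up]; have [f fu] := cauchy_limit up.
exists f.
  (* The tolerance at k = 0 is 1, so [f] differs from a function of finite norm by one of norm at
     most 1. *)
  have -> : f = u (p 0) - (u (p 0) - f) by rewrite subKr.
  apply: le_lt_trans (essnormD hw _ _) _; rewrite essnormN.
  apply: lte_add_pinfty; first exact: uL.
  by apply: le_lt_trans (fu _ _ (leqnn _)) _; rewrite ltry.
have fin n k : (p k <= n)%N -> essnorm mu (u n - f) \is a fin_num.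
  move=> pn; rewrite ge0_fin_numE ?essnorm_ge0//.
  by apply: le_lt_trans (fu _ _ pn) _; rewrite ltry.
(* Convergence in the extended reals reduces to real convergence once the norms are finite, which
   holds from [p 0] on. *)
apply/fine_cvgP; split; first by exists (p 0) => // n /= /fin.
apply/cvgrPdist_lt => e /inv_natS_lt[k ke]; exists (p k) => // n /= pn.
rewrite sub0r normrN ger0_norm ?fine_ge0 ?essnorm_ge0//.
rewrite -lte_fin fineK ?(fin _ _ pn)//.
by apply: le_lt_trans (fu _ _ pn) _; rewrite lte_fin.
Qed.

Lemma class_ofB f g : class_of hw (f - g) = class_of hw f - class_of hw g.
Proof. by rewrite class_ofD -scaleN1r class_ofZ scaleN1r. Qed.

(** Transfers the Cauchy condition from classes to their canonical representatives. *)
Lemma Lnorm_inftyB x y :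
  Lnorm_infty hw (x - y) = essnorm mu (repr x - repr y).
Proof.
by rewrite -{1}(class_of_repr x) -{1}(class_of_repr y) -class_ofB Lnorm_inftyE.
Qed.

Lemma Linfty_complete : seminorm_complete (Linfty hw) (Lnorm_infty hw).
Proof.
move=> u uL cu.
(* The function witnessing membership in [Linfty] need not be the canonical representative, but
   equivalent functions have equal norm. *)
have rL n : calLinfty mu (repr (u n)).
  have [f fL <-] := uL n.
  by rewrite /calLinfty/= -[essnorm _ _]/(Lnorm_infty hw _) Lnorm_inftyE.
have [e e0|f fL uf] := @calLinfty_complete (fun n => repr (u n)) rL.
  have [n0 un0] := cu e e0; exists n0 => m n n0m n0n.
  by rewrite -Lnorm_inftyB un0.
exists (class_of hw f); first by exists f.
apply: cvg_trans uf; apply: near_eq_cvg; apply: nearW => n.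
by rewrite -[u n in RHS](class_of_repr) -class_ofB Lnorm_inftyE.
Qed.

End completeness.

Theorem theorem8p3 (d : measure_display) (T : measurableType d) (R : realType)
    (mu : nonadditive_measure T R)
    (hw : weakly_null_additive mu) (hc : null_continuous mu) :
  seminorm_complete (calLinfty mu) (essnorm mu) /\
  seminorm_complete (Linfty hw) (Lnorm_infty hw).
Proof. by split; [exact: calLinfty_complete|exact: Linfty_complete]. Qed.
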